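(* $\mathrm{ex}'(n,\{\text{taco},\text{nested}\})\in\Theta\big(\mathrm{ex}'(n,\{\text{taco},\text{nested},\text{bat},\text{ears}\})\big)$.
   Context: Let $P$ be a set of $n$ points in convex position in the plane (the vertices of a convex $n$-gon); a triangle on $P$ is a 3-element subset of $P$. For two distinct triangles $t_1,t_2$ on $P$, label each point of $t_1\cup t_2$ by the triangle(s) containing it and read the points in their cyclic order around the polygon. The pair forms exactly one of eight configurations. (i) If $t_1,t_2$ share two vertices $u,v$: ''taco'' if their third vertices lie on the same side of the line $uv$, ''mariposa'' if on opposite sides. (ii) If they share exactly one vertex $v$: read the remaining four vertices in cyclic order starting just after $v$; ''bat'' if the pattern is $t_1t_1t_2t_2$ or $t_2t_2t_1t_1$, ''nested'' if it is $t_1t_2t_2t_1$ or $t_2t_1t_1t_2$, ''crossing'' if it is $t_1t_2t_1t_2$ or $t_2t_1t_2t_1$. (iii) If they share no vertex, the cyclic sequence of the six labels is, up to rotation, reflection and exchanging the roles of $t_1,t_2$, one of: ''ears'' $AAABBB$, ''swords'' $AABABB$, ''david'' $ABABAB$. Top/bottom variant: partition the vertices of the convex $n$-gon by a horizontal line into a top half of $\lceil n/2\rceil$ vertices and a bottom half of $\lfloor n/2\rfloor$ vertices (each half consisting of consecutive vertices along the polygon). For a set $X$ of configurations, $\mathrm{ex}'(n,X)$ is the maximum size of a family of triangles on $P$, each having exactly two vertices in the top half and one vertex in the bottom half, in which no two triangles form a configuration belonging to $X$. *)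

(* Defs.v *)
From mathcomp Require Import all_boot all_order all_algebra.
From mathcomp Require Import zify ring.

Set Implicit Arguments.
Unset Strict Implicit.
Unset Printing Implicit Defensive.

Import Order.TTheory GRing.Theory Num.Theory.

(* The vertices of the convex n-gon are labelled 0, ..., n-1 in cyclic order.
   The configurations depend on the points only through this order: a line
   through two vertices u, v separates two other vertices iff these lie on
   different arcs of the polygon between u and v (lemma same_sideE below). *)

Inductive config :=
  Taco | Mariposa | Bat | Nested | Crossing | Ears | Swords | David.

Section Configurations.
Variable n : nat.
Implicit Types (t : {set 'I_n}) (u v x y : 'I_n) (s : seq 'I_n) (w : seq bool).

(* All the vertices in cyclic order, beginning just after v and ending at v. *)
Definition cyc_from v : seq 'I_n := rot v.+1 (enum 'I_n).

(* x is met before v when going around the polygon from u. *)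
Definition on_arc u v x : bool := index x (cyc_from u) < index v (cyc_from u).

Definition same_side u v x y : bool := on_arc u v x == on_arc u v y.

Definition share_two (side : 'I_n -> 'I_n -> 'I_n -> 'I_n -> bool) t1 t2 : bool :=
  [exists u : 'I_n, exists v : 'I_n, exists x : 'I_n, exists y : 'I_n,
    [&& uniq [:: u; v; x; y], t1 == [set u; v; x]%SET, t2 == [set u; v; y]%SET
      & side u v x y]].

(* The labels (true for t1, false for t2) of the unshared vertices of t1 and
   t2, in the order in which these vertices occur in s. *)
Definition labels t1 t2 s : seq bool :=
  [seq x \in t1 | x <- s & (x \in t1) (+) (x \in t2)].

Definition share_one w t1 t2 : bool :=
  [exists v : 'I_n, (t1 :&: t2 == [set v])%SET &&
    (labels t1 t2 (cyc_from v) \in [:: w; map negb w])].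

(* The words obtained from w by rotation, reflection and exchange of labels. *)
Definition variants w : seq (seq bool) :=
  [seq rot k w' | w' <- [:: w; rev w; map negb w; rev (map negb w)],
                  k <- iota 0 (size w)].

Definition share_none w t1 t2 : bool :=
  (t1 :&: t2 == set0)%SET && (labels t1 t2 (enum 'I_n) \in variants w).

Definition forms (c : config) t1 t2 : bool :=
  let A := true in let B := false in
  match c with
  | Taco => share_two same_side t1 t2
  | Mariposa => share_two (fun u v x y => ~~ same_side u v x y) t1 t2
  | Bat => share_one [:: A; A; B; B] t1 t2
  | Nested => share_one [:: A; B; B; A] t1 t2
  | Crossing => share_one [:: A; B; A; B] t1 t2
  | Ears => share_none [:: A; A; A; B; B; B] t1 t2
  | Swords => share_none [:: A; A; B; A; B; B] t1 t2
  | David => share_none [:: A; B; A; B; A; B] t1 t2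
  end.

(* The labelling starts at the first vertex of the top half, so the top half
   is {0, ..., ceil(n/2) - 1} and the bottom half is the rest. *)
Definition top_half : {set 'I_n} := [set i : 'I_n | i < uphalf n]%SET.
Definition bottom_half : {set 'I_n} := [set i : 'I_n | uphalf n <= i]%SET.

Definition top_bottom_triangle t : bool :=
  [&& #|t| == 3, #|t :&: top_half|%SET == 2 & #|t :&: bottom_half|%SET == 1].

Definition admissible (X : seq config) (F : {set {set 'I_n}}) : bool :=
  [forall t in F, top_bottom_triangle t] &&
  [forall t1 in F, forall t2 in F,
    (t1 != t2) ==> ~~ has (fun c => forms c t1 t2) X].

End Configurations.

Definition ex' (n : nat) (X : seq config) : nat :=
  \max_(F : {set {set 'I_n}} | admissible X F) #|F|.

Section Geometry.
Variables (R : realDomainType) (n : nat) (p : 'I_n -> R * R).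
Local Open Scope ring_scope.

(* Positive iff a, b, c are in counterclockwise position. *)
Definition orient (a b c : R * R) : R :=
  (b.1 - a.1) * (c.2 - a.2) - (b.2 - a.2) * (c.1 - a.1).

Lemma index_cyc_from (u x : 'I_n) :
  index x (cyc_from u) = (if (x <= u)%N then x + n - u.+1 else x - u.+1)%N.
Proof.
have ltun := ltn_ord u; have ltxn := ltn_ord x.
have uniq_c : uniq (cyc_from u) by rewrite rot_uniq enum_uniq.
set i := (X in _ = X).
have lti : (i < size (cyc_from u))%N.
  by rewrite size_rot size_enum_ord /i; case: ifP; lia.
rewrite -[RHS](index_uniq x lti uniq_c); congr index.
apply/val_inj; rewrite /cyc_from /rot nth_cat size_drop size_enum_ord /i.
have [xu|xu] := leqP x u.
  rewrite ifN; last by lia.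
  by rewrite nth_take /= ?nth_enum_ord; lia.
rewrite ifT; last by lia.
by rewrite nth_drop /= nth_enum_ord; lia.
Qed.

Lemma on_arcE (u v x : 'I_n) :
    (forall i j k : 'I_n, (i < j < k)%N -> 0 < orient (p i) (p j) (p k)) ->
    uniq [:: u; v; x] ->
  (orient (p u) (p v) (p x) != 0) /\
  on_arc u v x = (orient (p u) (p v) (p x) < 0).
Proof.
move=> ccw; rewrite /= !inE -!(inj_eq val_inj) /= => /and3P[uvx vx _].
have rotE a b c : orient b c a = orient a b c by rewrite /orient; ring.
have oppE a b c : orient a c b = - orient a b c by rewrite /orient; ring.
have pos i j k : 0 < orient (p i) (p j) (p k) -> on_arc i j k = false ->
    (orient (p i) (p j) (p k) != 0) /\
    on_arc i j k = (orient (p i) (p j) (p k) < 0).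
  by move=> h ->; split; [rewrite gt_eqF | rewrite lt_gtF].
have neg i j k : 0 < orient (p i) (p k) (p j) -> on_arc i j k ->
    (orient (p i) (p j) (p k) != 0) /\
    on_arc i j k = (orient (p i) (p j) (p k) < 0).
  by rewrite oppE oppr_gt0 => h ->; rewrite h lt_eqF.
have ltun := ltn_ord u; have ltvn := ltn_ord v; have ltxn := ltn_ord x.
have arc b : b = ((u < x < v) || (x < v < u) || (v < u < x))%N ->
    on_arc u v x = b.
  by move=> ->; rewrite /on_arc !index_cyc_from; do 2! case: ifP; lia.
have [h|h] := boolP ((u < x < v) || (x < v < u) || (v < u < x))%N.
  apply: neg; last by apply: arc; rewrite h.
  move: h => /orP[/orP[]|] h; first exact: ccw.
    by rewrite -rotE; apply: ccw.
  by rewrite rotE; apply: ccw.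
apply: pos; last by apply/arc/esym/negbTE.
have {}h : ((u < v < x) || (v < x < u) || (x < u < v))%N by lia.
move: h => /orP[/orP[]|] h; first exact: ccw.
  by rewrite -rotE; apply: ccw.
by rewrite rotE; apply: ccw.
Qed.

(* In every realization of the cyclic order by points in convex position,
   same_side is the geometric relation. *)
Lemma same_sideE (u v x y : 'I_n) :
    (forall i j k : 'I_n, (i < j < k)%N -> 0 < orient (p i) (p j) (p k)) ->
    uniq [:: u; v; x; y] ->
  same_side u v x y =
    (0 < orient (p u) (p v) (p x) * orient (p u) (p v) (p y)).
Proof.
move=> ccw; rewrite /= !inE !negb_or => /and4P[/and3P[uv ux uy] /andP[vx vy] _ _].
have [|nx ex] := @on_arcE u v x ccw; first by rewrite /= !inE negb_or uv ux vx.
have [|ny ey] := @on_arcE u v y ccw; first by rewrite /= !inE negb_or uv uy vy.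
rewrite /same_side ex ey.
case: ltgtP nx => // hx _; case: ltgtP ny => // hy _ /=.
- by rewrite nmulr_rgt0.
- by rewrite nmulr_rgt0 // lt_gtF.
- by rewrite pmulr_rgt0 // lt_gtF.
- by rewrite pmulr_rgt0.
Qed.

End Geometry.

(* Main.v *)
Require Import Defs.
From mathcomp Require Import all_boot all_order all_algebra.
From mathcomp Require Import zify.

Set Implicit Arguments.
Unset Strict Implicit.
Unset Printing Implicit Defensive.

Import Order.TTheory GRing.Theory Num.Theory.

(* Write a triangle with two top vertices a < b and bottom vertex c as the
   triple (a, b, c). Taco- and nested-freeness says exactly that two triples
   which agree in one coordinate are strictly ordered in the same way in the
   two others. This condition does not compare a vertex a with a vertex b, so
   it survives moving the left vertices and the right vertices independently
   by order-preserving maps. Let h be half the size of the top half: cut the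
   top half into three blocks of size at most h, keep the most frequent of the
   nine pairs (block of a, block of b), and move its a's to [0, h) and its b's
   to [h, 2h). Now all the triangles straddle h, whereas a bat or an ears of
   triples (a, b, c) and (a', b', c') needs b <= a' or b' <= a. *)

Ltac ord_lia := rewrite !inE -!(inj_eq val_inj) /=; lia.

(** * Sorted lists, residues, and reading off labels *)

Lemma sorted_index (T : eqType) (s : seq T) :
  uniq s -> sorted (relpre (index^~ s) ltn) s.
Proof.
move=> us; rewrite -sorted_map.
suff -> : map (index^~ s) s = iota 0 (size s) by exact: iota_ltn_sorted.
case: s us => // x0 s us.
apply: (@eq_from_nth _ 0) => [|i]; rewrite size_map ?size_iota // => lt_i.
by rewrite (nth_map x0) // index_uniq // nth_iota.
Qed.

Lemma ltn_same_block (h x y : nat) :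
  x %/ h = y %/ h -> (x %% h < y %% h) = (x < y).
Proof. by move=> e; rewrite {2}(divn_eq x h) {2}(divn_eq y h) e ltn_add2l. Qed.

Lemma eq_same_block (h x y : nat) : x %/ h = y %/ h -> x %% h = y %% h -> x = y.
Proof. by move=> e e'; rewrite (divn_eq x h) (divn_eq y h) e e'. Qed.

Section Triangles.
Variable n : nat.
Implicit Types (t : {set 'I_n}) (a b c u v x y : 'I_n) (s l : seq 'I_n).

(** A list strictly sorted for a transitive irreflexive relation is determined by its members. So a
    label word is found by exhibiting the unshared vertices in order, without computing the filter
    over all of [s]. *)
Lemma labels_sorted t1 t2 s l :
    uniq s -> sorted (relpre (index^~ s) ltn) l ->
    l =i [pred x in s | (x \in t1) (+) (x \in t2)] ->
  labels t1 t2 s = map (mem t1) l.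
Proof.
move=> us sl el; congr map.
apply: (@irr_sorted_eq _ (relpre (index^~ s) ltn)) => //.
- by move=> y x z /=; apply: ltn_trans.
- by move=> x /=; rewrite ltnn.
- apply: sorted_filter (sorted_index us).
  by move=> y x z /=; apply: ltn_trans.
- by move=> x; rewrite mem_filter el !inE andbC.
Qed.

Lemma labels_enum t1 t2 l :
    sorted (relpre val ltn) l ->
    (forall x, (x \in l) = (x \in t1) (+) (x \in t2)) ->
  labels t1 t2 (enum 'I_n) = map (mem t1) l.
Proof.
move=> sl el; apply: labels_sorted; first exact: enum_uniq.
  by apply: sub_sorted sl => x y /=; rewrite !index_enum_ord.
by move=> x; rewrite el !inE mem_enum.
Qed.

Lemma labels_cyc_from t1 t2 v l :
    sorted (relpre (index^~ (cyc_from v)) ltn) l ->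
    (forall x, (x \in l) = (x \in t1) (+) (x \in t2)) ->
  labels t1 t2 (cyc_from v) = map (mem t1) l.
Proof.
move=> sl el; apply: labels_sorted => // [|x].
  by rewrite rot_uniq enum_uniq.
by rewrite el !inE mem_rot mem_enum.
Qed.

(** * Triangles as triples, and the order condition on them *)

Definition tri a b c : {set 'I_n} := [set a; b; c]%SET.

Definition tb_triple a b c : bool := [&& a < b, b < uphalf n & uphalf n <= c].

Lemma top_bottom_triangleP t :
  reflect (exists a b c, tb_triple a b c /\ t = tri a b c)
          (top_bottom_triangle t).
Proof.
apply: (iffP idP) => [|[a [b [c [/and3P[ab bm mc] ->]]]]].
  case/and3P=> _ /cards2P[a [b [ab tT]]] /cards1P[c tB].
  have tE : t = tri a b c.
    rewrite /tri -tT -tB -setIUr; apply/esym/setIidPl/subsetP => x _.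
    by rewrite !inE; lia.
  have /setIP[_] : a \in t :&: top_half n by rewrite tT !inE eqxx.
  have /setIP[_] : b \in t :&: top_half n by rewrite tT !inE eqxx orbT.
  have /setIP[_] : c \in t :&: bottom_half n by rewrite tB !inE.
  rewrite !inE => mc bm am.
  move: ab; rewrite -(inj_eq val_inj) /= neq_ltn => /orP[] ab.
    by exists a, b, c; rewrite /tb_triple ab bm.
  by exists b, a, c; rewrite /tb_triple ab am tE /tri (setUC [set a]).
apply/and3P; split.
- by rewrite /tri -setUA cardsU1 cards2 !inE -!(inj_eq val_inj) /=; lia.
- have -> : tri a b c :&: top_half n = [set a; b].
    by apply/setP => x; ord_lia.
  by rewrite cards2 -(inj_eq val_inj) /=; lia.
- have -> : tri a b c :&: bottom_half n = [set c].
    by apply/setP => x; ord_lia.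
  by rewrite cards1.
Qed.

Lemma tri_inj a b c a' b' c' :
    tb_triple a b c -> tb_triple a' b' c' -> tri a b c = tri a' b' c' ->
  [/\ a = a', b = b' & c = c'].
Proof.
rewrite /tb_triple => h h' /setP e.
move: (e a) (e b) (e c) (e a') (e b') (e c').
rewrite !inE -!(inj_eq val_inj) /= !eqxx /= => ? ? ? ? ? ?.
by split; apply/val_inj => /=; lia.
Qed.

(** This is one direction of the order condition; the other is obtained by exchanging the two
    triples. The arguments are natural numbers, so that the condition also makes sense for shifted
    coordinates. *)
Definition co_ordered (a b c a' b' c' : nat) : Prop :=
  [/\ a = a' -> b = b' -> c = c',
      a = a' -> b < b' -> c < c',
      b = b' -> a < a' -> c < c'
    & c = c' -> a < a' -> b < b'].

(** * From forbidden tacos and nested pairs to co-ordering *)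

Lemma taco_tri u v x y :
    uniq [:: u; v; x; y] -> same_side u v x y ->
  forms Taco [set u; v; x]%SET [set u; v; y]%SET.
Proof.
move=> uq ss; apply/existsP; exists u; apply/existsP; exists v.
by apply/existsP; exists x; apply/existsP; exists y; rewrite uq !eqxx.
Qed.

Lemma same_side_arith u v x y :
  ((u < x < v) || (x < v < u) || (v < u < x)) =
  ((u < y < v) || (y < v < u) || (v < u < y)) ->
  uniq [:: u; v; x; y] -> same_side u v x y.
Proof.
have arc (z : 'I_n) : u != z :> nat -> v != z :> nat -> u != v :> nat ->
    on_arc u v z = ((u < z < v) || (z < v < u) || (v < u < z)).
  have := ltn_ord u; have := ltn_ord v; have := ltn_ord z.
  by rewrite /on_arc !index_cyc_from; do 2! case: ifP; lia.
move=> e; rewrite /= !inE -!(inj_eq val_inj) /= => uq.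
by rewrite /same_side !arc; lia.
Qed.

Lemma nested_tri t1 t2 v x1 x2 x3 x4 :
    (t1 :&: t2)%SET = [set v]%SET ->
    (forall x, (x \in [:: x1; x2; x3; x4]) = (x \in t1) (+) (x \in t2)) ->
    sorted (relpre (index^~ (cyc_from v)) ltn) [:: x1; x2; x3; x4] ->
    [&& x1 \in t1, x2 \notin t1, x3 \notin t1 & x4 \in t1] ||
    [&& x1 \notin t1, x2 \in t1, x3 \in t1 & x4 \notin t1] ->
  forms Nested t1 t2.
Proof.
move=> tv sd sl w; apply/existsP; exists v; rewrite tv eqxx.
rewrite (labels_cyc_from sl sd) /=.
by move: w; do 4! case: (_ \in t1) => //=.
Qed.

(** Each clause is proved by contradiction. If two coordinates agree and the third does not, the
    pair is a taco. If one agrees and the other two move in opposite directions, the vertices read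
    from the shared one are labelled ABBA or BAAB, so the pair is nested. *)
Lemma taco_nested_free_co_ordered a b c a' b' c' :
    tb_triple a b c -> tb_triple a' b' c' ->
    (tri a b c != tri a' b' c' ->
      ~~ has (fun f => forms f (tri a b c) (tri a' b' c')) [:: Taco; Nested]) ->
  co_ordered a b c a' b' c'.
Proof.
move=> tb tb' free.
have [/(tri_inj tb tb')[<- <- <-]|neq] := eqVneq (tri a b c) (tri a' b' c').
  by split=> //; rewrite ltnn.
move: tb tb' {free}(free neq); rewrite /tb_triple /= orbF.
move=> /and3P[ab bm mc] /and3P[ab' bm' mc'] /norP[/negP noT /negP noN].
have := ltn_ord c; have := ltn_ord c' => cn' cn.
split=> [/val_inj ea /val_inj eb|/val_inj ea lb|/val_inj eb la|/val_inj ec la];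
  subst.
- apply/eqP/negP => /negP /= nc; apply: noT.
  have uq : uniq [:: a'; b'; c; c'].
    by rewrite /=; ord_lia.
  by apply: taco_tri => //; apply: same_side_arith => //; lia.
- rewrite ltnNge; apply/negP; rewrite leq_eqVlt => /orP[/eqP/val_inj ec|lc].
    (* The unions are permuted to bring the common edge to the front, as [taco_tri] expects. *)
    apply: noT; rewrite /tri ec (setUAC _ [set b]) (setUAC _ [set b']).
    have uq : uniq [:: a'; c; b; b'].
      by rewrite /=; ord_lia.
    by apply: taco_tri => //; apply: same_side_arith => //; lia.
  apply: noN; apply: (@nested_tri _ _ a' b b' c' c).
  + by apply/setP => x; ord_lia.
  + by move=> x; ord_lia.
  + by rewrite /= !index_cyc_from; do ! (case: ifP => ? /=); lia.
  + by ord_lia.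
- rewrite ltnNge; apply/negP; rewrite leq_eqVlt => /orP[/eqP/val_inj ec|lc].
    apply: noT; rewrite /tri ec -!setUA (setUC [set a]) (setUC [set a']).
    have uq : uniq [:: b'; c; a; a'].
      by rewrite /=; ord_lia.
    by apply: taco_tri => //; apply: same_side_arith => //; lia.
  apply: noN; apply: (@nested_tri _ _ b' c' c a a').
  + by apply/setP => x; ord_lia.
  + by move=> x; ord_lia.
  + by rewrite /= !index_cyc_from; do ! (case: ifP => ? /=); lia.
  + by ord_lia.
- rewrite ltnNge; apply/negP; rewrite leq_eqVlt => /orP[/eqP/val_inj eb|lb].
    apply: noT; rewrite /tri -eb -!setUA (setUC [set a]) (setUC [set a']).
    have uq : uniq [:: b'; c'; a; a'].
      by rewrite /=; ord_lia.
    by apply: taco_tri => //; apply: same_side_arith => //; lia.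
  apply: noN; apply: (@nested_tri _ _ c' a a' b' b).
  + by apply/setP => x; ord_lia.
  + by move=> x; ord_lia.
  + by rewrite /= !index_cyc_from; do ! (case: ifP => ? /=); lia.
  + by ord_lia.
Qed.

(** * Co-ordered triangles that straddle [h] *)

Lemma shared_vertex h a b c a' b' c' u :
    tb_triple a b c -> tb_triple a' b' c' -> a < h <= b -> a' < h <= b' ->
    u \in tri a b c -> u \in tri a' b' c' ->
  [\/ u = a /\ a = a', u = b /\ b = b' | u = c /\ c = c'].
Proof.
move=> /and3P[ab bm mc] /and3P[ab' bm' mc'] abh abh'.
(* Mixed coincidences are impossible: left vertices lie below [h], right ones do not, and bottom
   vertices lie beyond the top half. *)
rewrite !inE => /orP[/orP[]|] /eqP-> /orP[/orP[]|] /eqP e;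
  have := congr1 val e => /= ev;
  by [constructor 1 | constructor 2 | constructor 3 | exfalso; lia].
Qed.

(** A common vertex has the same role in both triples, and agreement in two coordinates forces
    agreement in the third: a strict inequality there, in either direction, would make one of the
    equal coordinates strictly increase. This excludes tacos. *)
Lemma co_ordered_share_one h a b c a' b' c' u v :
    tb_triple a b c -> tb_triple a' b' c' -> a < h <= b -> a' < h <= b' ->
    co_ordered a b c a' b' c' -> co_ordered a' b' c' a b c ->
    tri a b c != tri a' b' c' ->
    u \in tri a b c -> u \in tri a' b' c' ->
    v \in tri a b c -> v \in tri a' b' c' ->
  u = v.
Proof.
move=> tb tb' abh abh' [co1 co2 co3 _] [_ co2' co3' _] neq u1 u2 v1 v2.
have {}neq : a = a' -> b = b' -> c = c' -> False.
  by move=> ea eb ec; rewrite ea eb ec eqxx in neq.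
have nab : a = a' -> b = b' -> False.
  by move=> ea eb; apply: neq => //; apply/val_inj/co1; rewrite ?ea ?eb.
have nac : a = a' -> c = c' -> False.
  move=> ea ec; apply: neq => //; apply/val_inj => /=; subst.
  by clear -co2 co2'; lia.
have nbc : b = b' -> c = c' -> False.
  move=> eb ec; apply: neq => //; apply/val_inj => /=; subst.
  by clear -co3 co3'; lia.
by case: (shared_vertex tb tb' abh abh' u1 u2) => [][-> ?];
  case: (shared_vertex tb tb' abh abh' v1 v2) => [][-> ?] //; exfalso; auto.
Qed.

(** The two words allowed for [w] are those of nested and bat; neither they nor their negations
    alternate. *)
Lemma alternating_share_one t1 t2 v x1 x2 x3 x4 w :
    (t1 :&: t2)%SET = [set v]%SET ->
    (forall x, (x \in [:: x1; x2; x3; x4]) = (x \in t1) (+) (x \in t2)) ->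
    sorted (relpre (index^~ (cyc_from v)) ltn) [:: x1; x2; x3; x4] ->
    [&& x1 \in t1, x2 \notin t1, x3 \in t1 & x4 \notin t1] ||
    [&& x1 \notin t1, x2 \in t1, x3 \notin t1 & x4 \in t1] ->
    w \in [:: [:: true; false; false; true]; [:: true; true; false; false]] ->
  ~~ share_one w t1 t2.
Proof.
move=> tv sd sl alt ww; apply/negP => /existsP[u].
rewrite tv => /andP[/eqP/set1_inj <-]; apply/negP.
rewrite (labels_cyc_from sl sd) /=; move: alt ww; rewrite !inE.
by do 4! case: (_ \in t1) => //=; move=> _ /orP[] /eqP->.
Qed.

(** Once one coordinate is shared, the other two move strictly in the same direction. Read from the
    shared vertex, both vertices of one role precede both of the other; when the bottom vertex is
    shared, this is where straddling enters, through [a' < h <= b]. The labels therefore alternate: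
    the pair is a crossing. *)
Lemma straddling_share_one h a b c a' b' c' w :
    tb_triple a b c -> tb_triple a' b' c' -> a < h <= b -> a' < h <= b' ->
    co_ordered a b c a' b' c' -> co_ordered a' b' c' a b c ->
    tri a b c != tri a' b' c' ->
    w \in [:: [:: true; false; false; true]; [:: true; true; false; false]] ->
  ~~ share_one w (tri a b c) (tri a' b' c').
Proof.
move=> tb tb' abh abh' co co' neq ww.
have [|no_v] :=
  boolP [exists v, (tri a b c :&: tri a' b' c')%SET == [set v]%SET]; last first.
  apply/negP => /existsP[v /andP[tv _]].
  by move/existsP: no_v; apply; exists v.
case/existsP=> v /eqP tv.
have /setIP[v1 v2] : v \in (tri a b c :&: tri a' b' c')%SET by rewrite tv inE.
have [ab bm mc] := and3P tb; have [ab' bm' mc'] := and3P tb'.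
have [ah hb] := andP abh; have [ah' hb'] := andP abh'.
(* The symmetric difference is the union without [v]; in this form, membership reduces to linear
   arithmetic. *)
have sd : forall x, (x \in tri a b c) (+) (x \in tri a' b' c') =
    (x != v) && ((x \in tri a b c) || (x \in tri a' b' c')).
  move=> x; have := congr1 (fun A : {set 'I_n} => x \in A) tv.
  rewrite /= in_setI in_set1.
  by case: (x \in tri a b c); case: (x \in tri a' b' c'); case: (x == v).
have := ltn_ord c; have := ltn_ord c' => cn' cn.
have {}neq : ~ [/\ a = a', b = b' & c = c'].
  by case=> ea eb ec; rewrite ea eb ec eqxx in neq.
case: co co' => [co1 co2 co3 co4] [co1' co2' co3' co4'].
case: (shared_vertex tb tb' abh abh' v1 v2) neq => [][ev e]
  {tb tb' abh abh' v1 v2} neq; subst v; subst.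
- have : (b < b') && (c < c') || (b' < b) && (c' < c).
    have [lb|lb|/val_inj eb] := ltngtP b b'; first by rewrite co2.
      by rewrite co2' ?orbT.
    by case: neq; split=> //; apply/val_inj/co1; rewrite ?eb.
  clear -tv sd ww ab bm mc ab' bm' mc' ah hb ah' hb' cn cn'.
  case/orP=> /andP[lb lc].
  + apply: (@alternating_share_one _ _ _ b b' c c' _ tv) ww.
    * by move=> x; rewrite sd; clear sd tv; ord_lia.
    * by clear sd tv; rewrite /= !index_cyc_from; do ! (case: ifP => ? /=); lia.
    * by clear sd tv; ord_lia.
  + apply: (@alternating_share_one _ _ _ b' b c' c _ tv) ww.
    * by move=> x; rewrite sd; clear sd tv; ord_lia.
    * by clear sd tv; rewrite /= !index_cyc_from; do ! (case: ifP => ? /=); lia.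
    * by clear sd tv; ord_lia.
- have : (a < a') && (c < c') || (a' < a) && (c' < c).
    have [la|la|/val_inj ea] := ltngtP a a'; first by rewrite co3.
      by rewrite co3' ?orbT.
    by case: neq; split=> //; apply/val_inj/co1; rewrite ?ea.
  clear -tv sd ww ab bm mc ab' bm' mc' ah hb ah' hb' cn cn'.
  case/orP=> /andP[lb lc].
  + apply: (@alternating_share_one _ _ _ c c' a a' _ tv) ww.
    * by move=> x; rewrite sd; clear sd tv; ord_lia.
    * by clear sd tv; rewrite /= !index_cyc_from; do ! (case: ifP => ? /=); lia.
    * by clear sd tv; ord_lia.
  + apply: (@alternating_share_one _ _ _ c' c a' a _ tv) ww.
    * by move=> x; rewrite sd; clear sd tv; ord_lia.
    * by clear sd tv; rewrite /= !index_cyc_from; do ! (case: ifP => ? /=); lia.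
    * by clear sd tv; ord_lia.
- have : (a < a') && (b < b') || (a' < a) && (b' < b).
    have [la|la|/val_inj ea] := ltngtP a a'; first by rewrite co4.
      by rewrite co4' ?orbT.
    subst; case: neq; split=> //; apply/val_inj => /=.
    by clear -co2 co2'; lia.
  clear -tv sd ww ab bm mc ab' bm' mc' ah hb ah' hb' cn cn'.
  case/orP=> /andP[lb lc].
  + apply: (@alternating_share_one _ _ _ a a' b b' _ tv) ww.
    * by move=> x; rewrite sd; clear sd tv; ord_lia.
    * by clear sd tv; rewrite /= !index_cyc_from; do ! (case: ifP => ? /=); lia.
    * by clear sd tv; ord_lia.
  + apply: (@alternating_share_one _ _ _ a' a b' b _ tv) ww.
    * by move=> x; rewrite sd; clear sd tv; ord_lia.
    * by clear sd tv; rewrite /= !index_cyc_from; do ! (case: ifP => ? /=); lia.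
    * by clear sd tv; ord_lia.
Qed.

Lemma straddling_not_ears h a b c a' b' c' :
    tb_triple a b c -> tb_triple a' b' c' -> a < h <= b -> a' < h <= b' ->
  ~~ forms Ears (tri a b c) (tri a' b' c').
Proof.
move=> /and3P[ab bm mc] /and3P[ab' bm' mc'] /andP[ah hb] /andP[ah' hb'].
apply/negP=> /andP[/eqP/setP t12]; apply/negP.
move: (t12 a) (t12 b) (t12 c).
rewrite !inE -!(inj_eq val_inj) /= => na nb nc.
have {}na : a != a' :> nat by clear -na; lia.
have {}nb : b != b' :> nat by clear -nb; lia.
have {}nc : c != c' :> nat by clear -nc; lia.
have [a1 b1 c1] : [/\ a \in tri a b c, b \in tri a b c & c \in tri a b c].
  by rewrite !inE !eqxx !orbT.
have [a2 b2 c2] : [/\ a' \in tri a b c = false, b' \in tri a b c = false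
                    & c' \in tri a b c = false].
  by clear t12; split; ord_lia.
clear t12.
(* The word is of the form x, ~x, y, ~y, z, ~z, hence has no cyclic run AAA. *)
pose pr x y := if x < y then [:: x; y] else [:: y; x].
rewrite (@labels_enum _ _ (pr a a' ++ pr b b' ++ pr c c')).
- by rewrite /pr; do 3! case: ifP => _ /=; rewrite a1 b1 c1 a2 b2 c2.
- by rewrite /pr; do 3! (case: ifP => ? /=); lia.
- by move=> x; rewrite /pr; do 3! (case: ifP => ? /=); ord_lia.
Qed.

Lemma straddling_free h a b c a' b' c' :
    tb_triple a b c -> tb_triple a' b' c' -> a < h <= b -> a' < h <= b' ->
    co_ordered a b c a' b' c' -> co_ordered a' b' c' a b c ->
    tri a b c != tri a' b' c' ->
  ~~ has (fun f => forms f (tri a b c) (tri a' b' c'))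
         [:: Taco; Nested; Bat; Ears].
Proof.
move=> tb tb' abh abh' co co' neq.
have noTaco : ~~ forms Taco (tri a b c) (tri a' b' c').
  apply/negP=> /existsP[u /existsP[v /existsP[x /existsP[y]]]].
  case/and4P=> /= /andP[+ _] /eqP e1 /eqP e2 _.
  rewrite inE negb_or => /andP[/eqP uv _]; apply: uv.
  apply: (co_ordered_share_one tb tb' abh abh' co co' neq).
  - by rewrite e1 !inE eqxx.
  - by rewrite e2 !inE eqxx.
  - by rewrite e1 !inE eqxx orbT.
  - by rewrite e2 !inE eqxx orbT.
rewrite -all_predC; apply/and5P; split=> //.
- exact: (straddling_share_one tb tb' abh abh').
- exact: (straddling_share_one tb tb' abh abh').
- exact: straddling_not_ears tb tb' abh abh'.
Qed.

(** * Moving left and right vertices to fixed blocks *)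

Definition left_shift h a : 'I_n := insubd a (a %% h).
(** The default [b] is never reached when [0 < h] and [h + h <= n]; for [left_shift], [a %% h <= a]
    always suffices. *)
Definition right_shift h b : 'I_n := insubd b (h + b %% h).

Lemma val_left_shift h a : val (left_shift h a) = a %% h.
Proof. by rewrite val_insubd (leq_ltn_trans (leq_mod a h)). Qed.

Lemma val_right_shift h b :
  0 < h -> h + h <= n -> val (right_shift h b) = h + b %% h.
Proof.
move=> h0 hn; rewrite val_insubd ifT //.
by apply: leq_trans hn; rewrite ltn_add2l ltn_pmod.
Qed.

Lemma co_ordered_shift h a b c a' b' c' :
    0 < h -> h + h <= n -> a %/ h = a' %/ h -> b %/ h = b' %/ h ->
    co_ordered a b c a' b' c' ->
  co_ordered (left_shift h a) (right_shift h b) c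
             (left_shift h a') (right_shift h b') c'.
Proof.
move=> h0 hn ea eb [co1 co2 co3 co4].
rewrite /co_ordered !val_left_shift !val_right_shift //.
rewrite !ltn_add2l !ltn_same_block //; split=> //.
- by move=> /(eq_same_block ea) + /addnI/(eq_same_block eb); apply: co1.
- by move=> /(eq_same_block ea); apply: co2.
- by move=> /addnI/(eq_same_block eb); apply: co3.
Qed.

Lemma shift_tb_triple a b c :
    let h := (uphalf n)./2 in 0 < h -> tb_triple a b c ->
  tb_triple (left_shift h a) (right_shift h b) c /\
  left_shift h a < h <= right_shift h b.
Proof.
move=> h h0 /and3P[ab bm mc].
have hn : h + h <= uphalf n by rewrite /h; lia.
have hn' : h + h <= n by rewrite /h; lia.
rewrite /tb_triple !val_left_shift !val_right_shift //.
have := ltn_pmod a h0; have := ltn_pmod b h0.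
by lia.
Qed.

(** * Counting by pairs of blocks *)

Definition block h (x : 'I_n * 'I_n * 'I_n) : 'I_3 * 'I_3 :=
  (inord (x.1.1 %/ h), inord (x.1.2 %/ h)).

Lemma ex'_taco_nested_le :
  2 < n -> ex' n [:: Taco; Nested] <= 9 * ex' n [:: Taco; Nested; Bat; Ears].
Proof.
move=> n2; set h := (uphalf n)./2.
have h0 : 0 < h by rewrite /h; lia.
have hn : h + h <= n by rewrite /h; lia.
apply/bigmax_leqP => F /andP[/forallP tbF /forallP freeF].
pose trix (x : 'I_n * 'I_n * 'I_n) := tri x.1.1 x.1.2 x.2.
pose S := [set x : 'I_n * 'I_n * 'I_n |
             tb_triple x.1.1 x.1.2 x.2 && (trix x \in F)]%SET.
have coS (x y : 'I_n * 'I_n * 'I_n) : x \in S -> y \in S ->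
    co_ordered x.1.1 x.1.2 x.2 y.1.1 y.1.2 y.2.
  rewrite !inE => /andP[tbx xF] /andP[tby yF].
  apply: taco_nested_free_co_ordered => // neq.
  have /implyP/(_ xF)/forallP/(_ (trix y))/implyP/(_ yF) := freeF (trix x).
  by rewrite neq.
have FS : #|F| <= #|S|.
  apply: leq_trans (leq_imset_card trix S); apply: subset_leq_card.
  apply/subsetP => t tF; have /implyP/(_ tF) := tbF t.
  case/top_bottom_triangleP=> a [b [c [tb tE]]].
  by apply/imsetP; exists (a, b, c); rewrite // inE /= tb /trix -tE.
(* Instead of selecting the most frequent pair of blocks, each of the nine classes is bounded by the
   right-hand [ex']. *)
apply: leq_trans FS _; rewrite -sum1_card (partition_big (block h) predT) //=.
have -> : 9 = #|{: 'I_3 * 'I_3}| by rewrite card_prod !card_ord.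
rewrite -sum_nat_const; apply: leq_sum => k _.
pose Sk := [set x in S | block h x == k]%SET.
have -> : \sum_(i in S | block h i == k) 1 = #|Sk|.
  by rewrite -sum1_card; apply: eq_bigl => x; rewrite !inE.
pose psi (x : 'I_n * 'I_n * 'I_n) :=
  tri (left_shift h x.1.1) (right_shift h x.1.2) x.2.
have Skx (x : 'I_n * 'I_n * 'I_n) :
    x \in Sk -> [/\ x \in S, tb_triple x.1.1 x.1.2 x.2 & block h x = k].
  by rewrite !inE => /andP[xS /eqP bx]; split=> //; case/andP: xS.
have blk (x y : 'I_n * 'I_n * 'I_n) : x \in Sk -> y \in Sk ->
    x.1.1 %/ h = y.1.1 %/ h /\ x.1.2 %/ h = y.1.2 %/ h.
  move=> /Skx[_ tbx bx] /Skx[_ tby]; rewrite -bx => -[e1 e2].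
  (* Three blocks suffice because [uphalf n <= 2 * h + 1 <= 3 * h]; hence [inord] in [block] never
     takes its default value on top vertices. *)
  have small (z : 'I_n) : z < uphalf n -> z %/ h < 3.
    by move=> zm; rewrite ltn_divLR // /h; lia.
  have [ax bx' _] := and3P tbx; have [ay by' _] := and3P tby.
  split; [have := congr1 val e1 | have := congr1 val e2];
  by rewrite /= !inordK ?small // (ltn_trans ax, ltn_trans ay).
(* The shifts keep only remainders, but the class [k] fixes the quotients, so the vertices can be
   recovered. *)
have psi_inj : {in Sk &, injective psi}.
  move=> [[a b] c] [[a' b'] c'] xS yS.
  have [/= ea eb] := blk _ _ xS yS.
  have [_ /= tb _] := Skx _ xS; have [_ /= tb' _] := Skx _ yS.
  have [tbx _] := shift_tb_triple h0 tb; have [tby _] := shift_tb_triple h0 tb'.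
  move/(tri_inj tbx tby) => /= [/(congr1 val) + /(congr1 val) + ->].
  rewrite !val_left_shift !val_right_shift //.
  by move=> /(eq_same_block ea)/val_inj-> /addnI/(eq_same_block eb)/val_inj->.
rewrite -(card_in_imset psi_inj); apply: leq_bigmax_cond; apply/andP; split.
  apply/forallP => t; apply/implyP => /imsetP[x /Skx[_ tbx _] ->].
  apply/top_bottom_triangleP.
  exists (left_shift h x.1.1), (right_shift h x.1.2), x.2.
  by split=> //; have [] := shift_tb_triple h0 tbx.
apply/forallP => t1; apply/implyP => /imsetP[x xS ->].
apply/forallP => t2; apply/implyP => /imsetP[y yS ->]; apply/implyP => neq.
have [ea eb] := blk _ _ xS yS.
have [xS' tb _] := Skx _ xS; have [yS' tb' _] := Skx _ yS.
have [tbx abx] := shift_tb_triple h0 tb.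
have [tby aby] := shift_tb_triple h0 tb'.
by apply: (straddling_free tbx tby abx aby) => //;
  apply: co_ordered_shift => //; apply: coS.
Qed.

Lemma ex'_le_taco_nested :
  ex' n [:: Taco; Nested; Bat; Ears] <= ex' n [:: Taco; Nested].
Proof.
apply/bigmax_leqP => F /andP[tbF /forallP freeF].
apply: leq_bigmax_cond; rewrite /admissible tbF /=.
apply/forallP => t1; apply/implyP => t1F.
apply/forallP => t2; apply/implyP => t2F; apply/implyP => neq.
have /implyP/(_ t1F)/forallP/(_ t2)/implyP/(_ t2F)/implyP/(_ neq) := freeF t1.
by apply: contra; rewrite /= orbF => /orP[] ->; rewrite ?orbT.
Qed.

End Triangles.

(* The asymptotic statement *)
From mathcomp Require Import all_classical all_reals all_analysis.

Local Open Scope ring_scope.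
Local Open Scope classical_set_scope.

Theorem theorem16 (R : realType) :
  (fun n : nat => (ex' n [:: Taco; Nested])%:R : R^o) \is
    'Theta_\oo (fun n : nat => (ex' n [:: Taco; Nested; Bat; Ears])%:R : R^o).
Proof.
(* The lower constant 1 comes from forbidding fewer configurations, the upper constant 9 from the
   pairs of blocks. The threshold 3 below makes the block length positive. *)
rewrite qualifE; apply/asboolP; exists (1, 9%:R).
  by rewrite /= ltr01 ltr0n.
exists 3%N => // n /= n3; rewrite mul1r !ger0_norm ?ler0n //.
by rewrite -natrM !ler_nat ex'_le_taco_nested ex'_taco_nested_le.
Qed.
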